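(* Let $A$ be a finite set of nonnegative integers such that $S(A)$ is an independent Stanley sequence with repeat factor $\rho$. Then there is an integer $\ell\ge 0$ such that $S(A)$ is a modular Stanley sequence modulo $3^\ell\cdot\rho$.
   Context: A set of integers is 3-free if it contains no three distinct terms in arithmetic progression. For a finite 3-free set $A=\{a_0<\cdots<a_k\}$ of nonnegative integers, the Stanley sequence $S(A)=(a_n)_{n\ge 0}$ is defined greedily: once $a_0<\cdots<a_n$ (with $n\ge k$) are defined, $a_{n+1}$ is the smallest integer greater than $a_n$ such that $\{a_0,\ldots,a_{n+1}\}$ is 3-free. $S(A)$ is also regarded as a set. A Stanley sequence $S(A)=(a_n)$ is independent if there exist constants $\lambda$ and $\kappa$ such that for all integers $k\ge\kappa$ and $0\le i<2^k$: $a_{2^k+i}=a_{2^k}+a_i$ and $a_{2^k}=2a_{2^k-1}-\lambda+1$. If $\kappa\geq 0$ is taken as small as possible, then $a_{2^\kappa}$ is called the repeat factor. For a positive integer $N$ and $A'\subseteq\{0,\ldots,N-1\}$: $A'$ is 3-free modulo $N$ if there are no $x,y,z\in A'$, not all equal, with $2y-z\equiv x\pmod N$; an integer $x$ is covered by $A'$ modulo $N$ if there exist $y,z\in A'$ with $z<y$ and $2y-z\equiv x\pmod N$. $A'$ is a modular set modulo $N$ if $0\in A'\subseteq\{0,\ldots,N-1\}$, $A'$ is 3-free modulo $N$, and every $x\in\{0,\ldots,N-1\}\setminus A'$ is covered by $A'$ modulo $N$. A sequence is a modular Stanley sequence modulo $N$ if it equals $S(A')$ for some modular set $A'$ modulo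 $N$. *)

(* Defs.v *)
From mathcomp Require Import all_boot all_order all_algebra.
From mathcomp Require Import finmap zify.

Set Implicit Arguments.
Unset Strict Implicit.
Unset Printing Implicit Defensive.

Definition three_free (s : seq nat) : bool :=
  all (fun x => all (fun y => all (fun z =>
    ~~ [&& x < y, y < z & x + z == 2 * y]) s) s) s.

Lemma three_freeP (s : seq nat) :
  reflect (forall x y z, x \in s -> y \in s -> z \in s ->
             x < y -> y < z -> x + z <> 2 * y)
          (three_free s).
Proof.
apply: (iffP allP) => [H x y z xs ys zs xy yz | H x xs].
  by move: (H _ xs) => /allP/(_ _ ys)/allP/(_ _ zs); rewrite xy yz /= => /eqP.
apply/allP => y ys; apply/allP => z zs; apply/negP => /and3P[xy yz /eqP].
exact: H.
Qed.

(* The guard [three_free s] only makes the choice of the least admissible x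
   total; it holds along every Stanley sequence started from a 3-free set. *)
Definition extends (s : seq nat) (x : nat) : bool :=
  (last 0 s < x) && (three_free s ==> three_free (rcons s x)).

Lemma extends_ex (s : seq nat) : exists x, extends s x.
Proof.
pose m := \max_(y <- s) y.
have le_m y : y \in s -> y <= m by move=> ys; exact: leq_bigmax_seq.
have lt_last : last 0 s <= m.
  by case: s @m le_m => [//|a s] m le_m; apply: le_m; exact: mem_last.
exists (2 * m).+1; apply/andP; split; first by lia.
apply/implyP => /three_freeP sf; apply/three_freeP => x y z.
rewrite !mem_rcons !inE => /predU1P[->|xs] /predU1P[->|ys] /predU1P[->|zs];
  try (have := le_m _ xs); try (have := le_m _ ys); try (have := le_m _ zs);
  try lia.
by move=> _ _ _; exact: sf.
Qed.

Definition next_term (s : seq nat) : nat := ex_minn (extends_ex s).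

(* After n greedy steps the list has #|` A| + n terms, so for nonempty A its
   n-th term is already determined. *)
Definition stanley (A : {fset nat}) (n : nat) : nat :=
  nth 0 (iter n (fun s => rcons s (next_term s)) (sort leq A)) n.

Definition independent_with (a : nat -> nat) (lambda : int) (kappa : nat) :=
  forall k i : nat, kappa <= k -> i < 2 ^ k ->
    a (2 ^ k + i) = a (2 ^ k) + a i /\
    ((a (2 ^ k)%N)%:Z = 2 * (a (2 ^ k - 1)%N)%:Z - lambda + 1)%R.

Definition independent (a : nat -> nat) : Prop :=
  exists (lambda : int) (kappa : nat), independent_with a lambda kappa.

Definition is_repeat_factor (a : nat -> nat) (rho : nat) : Prop :=
  exists kappa : nat,
    [/\ exists lambda : int, independent_with a lambda kappa,
        forall (lambda' : int) (kappa' : nat),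
          independent_with a lambda' kappa' -> kappa <= kappa'
      & rho = a (2 ^ kappa)].

(* Below, 2y - z = x (mod N) is written 2y = x + z (mod N), since subtraction
   on nat is truncated. *)
Definition three_free_mod (N : nat) (A : {fset nat}) : Prop :=
  forall x y z : nat, x \in A -> y \in A -> z \in A ->
    2 * y = x + z %[mod N] -> x = y /\ y = z.

Definition covered_mod (N : nat) (A : {fset nat}) (x : nat) : Prop :=
  exists y z : nat,
    [/\ y \in A, z \in A, z < y & 2 * y = x + z %[mod N]].

Definition modular_set (N : nat) (A : {fset nat}) : Prop :=
  [/\ 0 \in A,
      forall x, x \in A -> x < N,
      three_free_mod N A
    & forall x, x < N -> x \notin A -> covered_mod N A x].

Definition modular_stanley (N : nat) (a : nat -> nat) : Prop :=
  exists A : {fset nat}, modular_set N A /\ a =1 stanley A.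

(* Main.v *)
Require Import Defs.
From mathcomp Require Import all_boot all_order all_algebra.
From mathcomp Require Import finmap.
From mathcomp Require Import zify.

Set Implicit Arguments.
Unset Strict Implicit.

(** Write [a] for the sequence.  For [k] at least the independence threshold
    the two defining relations give [a (2 ^ k.+1) = 3 * a (2 ^ k)], so the
    numbers [3 ^ l * rho] are exactly the terms [N = a (2 ^ k)] (lemma
    [independent_geometric]).  The modular set is the block
    [B = {a 0, ..., a (2 ^ k - 1)}] below [N], for [k] large; the next block of
    the sequence is its translate [N + B].

    [B] is 3-free modulo [N], since a progression modulo [N] lifts to a genuine
    one inside the union of [B] and [N + B] ([block_three_free_mod]).

    [B] covers its complement ([block_covered_mod]).  An [x] beyond the seed [A]
    was skipped by the greedy rule, so it is the third term of a progression in
    [B].  A smaller [x] may have been skipped only because the seed is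
    arbitrary, but then [x + N] was skipped by the greedy rule, and the
    progression [z, y, x + N] responsible for it reduces modulo [N] to one in
    [B].  The order [z < y] could be lost only if [y] lies in [N + B] and [z] in
    [B], and then [x + z] is at least [N].  That is impossible once [N] is large
    compared with [x]: by the second defining relation the largest element of
    [B] is about [N / 2].

    Finally a long enough initial segment of a greedy sequence generates the
    same sequence ([stanley_prefix]), so [B] generates [a]. *)

(** * The greedy construction *)

Lemma next_term_gt (s : seq nat) : last 0 s < next_term s.
Proof. by rewrite /next_term; case: ex_minnP => m /andP[]. Qed.

Lemma three_free_next (s : seq nat) :
  three_free s -> three_free (rcons s (next_term s)).
Proof.
by move=> sf; rewrite /next_term; case: ex_minnP => m /andP[_ /implyP/(_ sf)].
Qed.

Lemma sorted_ltn_last (s : seq nat) (x : nat) :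
  sorted ltn s -> x \in s -> x <= last 0 s.
Proof.
case: (lastP s) => [//|t y]; rewrite last_rcons mem_rcons inE => st.
case/predU1P => [-> //|xt]; apply: ltnW.
move: st; rewrite (sorted_pairwise ltn_trans) pairwise_rcons => /andP[/allP h _].
exact: h.
Qed.

(** The only obstruction to appending a larger number to a 3-free list is a
    progression that ends in the new number. *)
Lemma skipped_by_next (s : seq nat) (x : nat) :
  sorted ltn s -> three_free s -> last 0 s < x < next_term s ->
  exists z y, [/\ z \in s, y \in s, z < y & 2 * y = x + z].
Proof.
move=> ss sf /andP[lx]; rewrite /next_term; case: ex_minnP => m _ mmin xm.
have: ~~ extends s x by apply/negP => /mmin; lia.
rewrite /extends lx sf /= => /allPn[u us] /allPn[v vs] /allPn[w ws].
rewrite negbK => /and3P[uv vw /eqP e].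
have bound t : t \in rcons s x -> t <= x.
  by rewrite mem_rcons inE => /predU1P[-> //|/(sorted_ltn_last ss)]; lia.
have below t : t \in rcons s x -> t < x -> t \in s.
  by rewrite mem_rcons inE => /predU1P[->|//]; rewrite ltnn.
have wx := bound _ ws.
have [u_s v_s] : u \in s /\ v \in s by split; apply: below => //; lia.
have [w_lt|w_ge] := ltnP w x.
  by case: (three_freeP _ sf u v w u_s v_s (below _ ws w_lt) uv vw e).
by exists u, v; split=> //; lia.
Qed.

Definition greedy_prefix (A : {fset nat}) (n : nat) : seq nat :=
  iter n (fun s => rcons s (next_term s)) (sort leq A).

Lemma size_greedy_prefix (A : {fset nat}) (n : nat) :
  size (greedy_prefix A n) = #|` A| + n.
Proof.
elim: n => [|n IH]; first by rewrite addn0 /= size_sort.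
by rewrite /greedy_prefix /= size_rcons -/(greedy_prefix A n) IH addnS.
Qed.

Lemma greedy_prefix_three_free (A : {fset nat}) (n : nat) :
  three_free A -> three_free (greedy_prefix A n).
Proof.
move=> /three_freeP Af; elim: n => [|n IH]; last exact: three_free_next.
by apply/three_freeP => x y z; rewrite !mem_sort; exact: Af.
Qed.

Lemma greedy_prefix_sorted (A : {fset nat}) (n : nat) :
  sorted ltn (greedy_prefix A n).
Proof.
elim: n => [|n]; first by rewrite ltn_sorted_uniq_leq sort_uniq fset_uniq
  (sort_sorted leq_total).
rewrite /greedy_prefix /= -/(greedy_prefix A n).
move: (next_term_gt (greedy_prefix A n)).
case: (greedy_prefix A n) => [//|t s] /= lt_last st.
by rewrite rcons_path st.
Qed.

Lemma greedy_prefix_stable (A : {fset nat}) (n d i : nat) :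
  i < #|` A| + n -> nth 0 (greedy_prefix A (n + d)) i = nth 0 (greedy_prefix A n) i.
Proof.
move=> lt_i; elim: d => [|d IH]; first by rewrite addn0.
rewrite addnS /greedy_prefix /= -/(greedy_prefix A (n + d)).
by rewrite nth_rcons size_greedy_prefix ifT ?IH //; lia.
Qed.

Lemma greedy_prefixE (A : {fset nat}) (n : nat) :
  A <> fset0 -> greedy_prefix A n = mkseq (stanley A) (#|` A| + n).
Proof.
move=> /eqP; rewrite -cardfs_gt0 => A0.
apply: (@eq_from_nth _ 0); first by rewrite size_mkseq size_greedy_prefix.
move=> i; rewrite size_greedy_prefix => lt_i; rewrite nth_mkseq //.
rewrite /stanley -/(greedy_prefix A i).
have [le_in|/ltnW le_ni] := leqP i n.
  by rewrite -(subnKC le_in) greedy_prefix_stable //; lia.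
by rewrite -{2}(subnKC le_ni) greedy_prefix_stable.
Qed.

(** * Stanley sequences as greedy sequences *)

Lemma stanley_lt (A : {fset nat}) (i j : nat) :
  A <> fset0 -> i < j -> stanley A i < stanley A j.
Proof.
move=> A0 lt_ij; have := greedy_prefix_sorted A j.+1.
rewrite greedy_prefixE // => st.
have := sorted_ltn_nth ltn_trans 0 st i j.
by rewrite !inE size_mkseq !nth_mkseq; [apply=> //; lia | lia | lia].
Qed.

Lemma stanley_three_free (A : {fset nat}) (i j k : nat) :
  A <> fset0 -> three_free A ->
  2 * stanley A j = stanley A i + stanley A k ->
  stanley A i = stanley A j /\ stanley A j = stanley A k.
Proof.
move=> A0 Af e.
have := greedy_prefix_three_free (i + j + k).+1 Af.
rewrite greedy_prefixE // => /three_freeP sf.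
have mem t : t <= i + j + k ->
    stanley A t \in mkseq (stanley A) (#|` A| + (i + j + k).+1).
  by move=> le_t; apply/mapP; exists t; rewrite // mem_iota; lia.
have mi := mem i ltac:(lia); have mj := mem j ltac:(lia).
have mk := mem k ltac:(lia).
have [lt|lt|] := ltngtP (stanley A i) (stanley A j); last lia.
- by case: (sf _ _ _ mi mj mk lt); lia.
- by case: (sf _ _ _ mk mj mi _ lt); lia.
Qed.

Lemma stanley_covers (A : {fset nat}) (x : nat) :
  A <> fset0 -> three_free A -> stanley A #|` A|.-1 < x ->
  (forall n, stanley A n <> x) ->
  exists i j, i < j /\ 2 * stanley A j = x + stanley A i.
Proof.
move=> A0 Af ltx notin.
have cA : 0 < #|` A| by move/eqP: A0; rewrite -cardfs_gt0.
have inc i j : i < j -> stanley A i < stanley A j by exact: stanley_lt.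
have ge_id n : n <= stanley A n.
  by elim: n => // n IH; apply: (leq_ltn_trans IH); apply: inc.
have ex_gt : exists n, x < stanley A n by exists x.+1; exact: ge_id.
case: (ex_minnP ex_gt) => n xn nmin.
have le_An : #|` A| <= n.
  rewrite leqNgt; apply/negP => ltn.
  have [e|ne] := eqVneq n #|` A|.-1; first by rewrite e in xn; lia.
  by have := inc n #|` A|.-1 ltac:(lia); lia.
have prev : stanley A n.-1 < x.
  have [//|gt|e] := ltngtP (stanley A n.-1) x; last by case: (notin _ e).
  by have := nmin _ gt; lia.
have last_s : last 0 (greedy_prefix A (n - #|` A|)) = stanley A n.-1.
  by rewrite -nth_last size_greedy_prefix greedy_prefixE // subnKC // nth_mkseq; lia.
have next_s : next_term (greedy_prefix A (n - #|` A|)) = stanley A n.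
  have := greedy_prefixE (n - #|` A|).+1 A0.
  rewrite {1}/greedy_prefix /= -/(greedy_prefix A (n - #|` A|)).
  move/(congr1 (fun s => last 0 s)); rewrite last_rcons => ->.
  by rewrite -nth_last size_mkseq addnS subnKC // nth_mkseq.
have lt_x : last 0 (greedy_prefix A (n - #|` A|)) < x
    < next_term (greedy_prefix A (n - #|` A|)).
  by rewrite last_s next_s prev xn.
have [z [y [zs ys zy e]]] := skipped_by_next (greedy_prefix_sorted _ _)
  (greedy_prefix_three_free _ Af) lt_x.
move: zs ys; rewrite greedy_prefixE // => /mapP[i _ zi] /mapP[j _ yj].
exists i, j; rewrite -zi -yj; split=> //.
rewrite ltnNge leq_eqVlt; apply/negP => /predU1P[eij|/inc]; last lia.
by move: zy; rewrite zi yj eij ltnn.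
Qed.

(** This makes the choice of seed irrelevant: any later state of the greedy
    construction may serve as one. *)
Lemma stanley_prefix (A : {fset nat}) (m : nat) :
  A <> fset0 -> #|` A| <= m ->
  stanley A =1 stanley [fset x in mkseq (stanley A) m]%fset.
Proof.
move=> A0 le_m n; rewrite {2}/stanley.
have -> : sort leq [fset x in mkseq (stanley A) m]%fset
        = greedy_prefix A (m - #|` A|).
  apply: (irr_sorted_eq ltn_trans ltnn).
  - by rewrite ltn_sorted_uniq_leq sort_uniq fset_uniq (sort_sorted leq_total).
  - exact: greedy_prefix_sorted.
  by move=> x; rewrite greedy_prefixE // subnKC // mem_sort !inE.
rewrite /greedy_prefix -iterD -/(greedy_prefix A _) greedy_prefixE //.
rewrite nth_mkseq //.
by move/eqP: A0; rewrite -cardfs_gt0; lia.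
Qed.

(** * Blocks of an independent sequence *)

(** The last term below [a (2 ^ k.+1)] is [a (2 ^ k)] plus the last term below
    [a (2 ^ k)], so the second defining relation at [k.+1] exceeds the one at
    [k] by [2 * a (2 ^ k)]. *)
Lemma independent_geometric (a : nat -> nat) (lambda : int) (kappa l : nat) :
  independent_with a lambda kappa ->
  a (2 ^ (kappa + l)) = 3 ^ l * a (2 ^ kappa).
Proof.
move=> ind; elim: l => [|l IH]; first by rewrite addn0 mul1n.
have p0 : 0 < 2 ^ (kappa + l) by rewrite expn_gt0.
have [_ e1] := ind (kappa + l) 0 ltac:(lia) p0.
have [_ e2] := ind (kappa + l.+1) 0 ltac:(lia) ltac:(by rewrite expn_gt0).
have [e3 _] := ind (kappa + l) (2 ^ (kappa + l) - 1) ltac:(lia) ltac:(lia).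
have e4 : 2 ^ (kappa + l) + (2 ^ (kappa + l) - 1) = 2 ^ (kappa + l.+1) - 1.
  by rewrite addnS expnS; lia.
rewrite e4 in e3; rewrite expnS -mulnA -IH; lia.
Qed.

Lemma mod_small_diff (N u v : nat) :
  u < 2 * N -> v < 2 * N -> u = v %[mod N] ->
  [\/ u = v, u = v + N | v = u + N].
Proof.
move=> ltu ltv e; rewrite (divn_eq u N) (divn_eq v N) e.
have : u %/ N < 2 by rewrite ltn_divLR //; lia.
have : v %/ N < 2 by rewrite ltn_divLR //; lia.
case: (u %/ N) => [|[|//]]; case: (v %/ N) => [|[|//]] _ _;
  [constructor 1|constructor 3|constructor 2|constructor 1]; lia.
Qed.

(** For terms below the modulus [a m], the difference [2 * y - (x + z)] can only
    be [0] or plus or minus [a m].  Translating [x], or both [x] and [y], into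
    the next block absorbs it and leaves a genuine progression. *)
Lemma block_three_free_mod (a : nat -> nat) (m : nat) :
  (forall i j, i < j -> a i < a j) ->
  (forall i j k, 2 * a j = a i + a k -> a i = a j /\ a j = a k) ->
  (forall i, i < m -> a (m + i) = a m + a i) ->
  three_free_mod (a m) [fset x in mkseq a m]%fset.
Proof.
move=> inc free shift x y z; rewrite !inE.
move=> /mapP[i + ->] /mapP[j + ->] /mapP[k + ->]; rewrite !mem_iota /= !add0n.
move=> im jm km e.
have := inc _ _ im; have := inc _ _ jm; have := inc _ _ km => kN jN iN.
have shi := shift _ im; have shj := shift _ jm.
have lt_2y : 2 * a j < 2 * a m by lia.
have lt_xz : a i + a k < 2 * a m by lia.
have [e1|e1|e1] := mod_small_diff lt_2y lt_xz e.
- exact: free.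
- by have := free (m + i) j k; lia.
- by have := free (m + i) (m + j) k; lia.
Qed.

(** Here [M] bounds the terms over which the greedy rule says nothing, and the
    gap [M + a m.-1 < a m] is what keeps the two terms covering [x] in order
    after reduction modulo [a m]. *)
Lemma block_covered_mod (a : nat -> nat) (m M : nat) :
  (forall i j, i < j -> a i < a j) ->
  (forall i, i < m -> a (m + i) = a m + a i) ->
  2 * a m <= a (2 * m) ->
  M + a m.-1 < a m ->
  (forall x, M < x -> (forall n, a n <> x) ->
     exists i j, i < j /\ 2 * a j = x + a i) ->
  forall x, x < a m -> x \notin [fset x in mkseq a m]%fset ->
    covered_mod (a m) [fset x in mkseq a m]%fset x.
Proof.
move=> inc shift dbl gap cov x xN xB.
have mono i j : i <= j -> a i <= a j.
  by rewrite leq_eqVlt => /predU1P[->//|/inc/ltnW].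
have inB i : i < m -> a i \in [fset x in mkseq a m]%fset.
  by move=> im; rewrite !inE; apply/mapP; exists i; rewrite // mem_iota.
have xa i : i < m -> a i <> x by move=> /inB + e; rewrite e; apply/negP.
have lt_inv N' i : a i < a N' -> i < N'.
  by move=> lt; rewrite ltnNge; apply/negP => /mono; lia.
have [Mx|xM] := ltnP M x.
  have [n e|i [j [ij e]]] := cov x Mx.
    by apply: (xa n) => //; apply: lt_inv; rewrite e.
  have := inc _ _ ij => aij; have jm : j < m by apply: lt_inv; lia.
  exists (a j), (a i); split=> //; try by apply: inB; lia.
  by rewrite e.
have [n e|i [j [ij e]]] := cov (x + a m) ltac:(lia).
  have nm : m <= n by rewrite leqNgt; apply/negP => /inc; lia.
  have n2 : n < 2 * m by apply: lt_inv; lia.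
  have := shift (n - m) ltac:(lia); rewrite subnKC // => en.
  by apply: (xa (n - m)); lia.
have := inc _ _ ij => aij.
have j2 : j < 2 * m by apply: lt_inv; lia.
have [jm|mj] := ltnP j m.
  exists (a j), (a i); split=> //; try by apply: inB; lia.
  by rewrite e addnAC modnDr.
have := shift (j - m) ltac:(lia); rewrite subnKC // => ej.
have [im|mi] := ltnP i m; last first.
  have := shift (i - m) ltac:(lia); rewrite subnKC // => ei.
  exists (a (j - m)), (a (i - m)); split; try by apply: inB; lia.
    by lia.
  by congr (_ %% _); lia.
(* y = N + y' and z < N: then x + z = 2 y' + N >= N > M + max B >= x + z. *)
have := mono i m.-1 ltac:(lia); lia.
Qed.

(** * The modulus of an independent sequence *)

Theorem proposition2p3 (A : {fset nat}) (rho : nat) :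
  A <> fset0 -> three_free A ->
  independent (stanley A) -> is_repeat_factor (stanley A) rho ->
  exists l : nat, modular_stanley (3 ^ l * rho) (stanley A).
Proof.
move=> A0 Af _ [kappa [[lambda ind] _ ->]].
have inc i j : i < j -> stanley A i < stanley A j by exact: stanley_lt.
have ge_id n : n <= stanley A n.
  by elim: n => // n IH; apply: (leq_ltn_trans IH); apply: inc.
pose M := stanley A #|` A|.-1.
(* With N = 2 max B - lambda + 1, the gap M + max B < N amounts to
   N > 2 M + lambda - 1; l is also at least #|A|, so that B contains A. *)
pose l := #|` A| + 2 * M + absz lambda.
exists l; rewrite -(independent_geometric _ ind).
set k := kappa + l; set m := 2 ^ k.
have lm : l < m by rewrite (leq_ltn_trans _ (ltn_expl k (ltnSn 1))) // leq_addl.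
have shift i : i < m -> stanley A (m + i) = stanley A m + stanley A i.
  by move=> im; have [] := ind k i (leq_addr _ _) im.
have [a0 eN] := ind k 0 (leq_addr _ _) ltac:(lia).
have Nm := ge_id m.
exists [fset x in mkseq (stanley A) m]%fset; split; last first.
  by apply: stanley_prefix => //; lia.
split.
- rewrite !inE; apply/mapP; exists 0; first by rewrite mem_iota; lia.
  by rewrite -/m addn0 in a0; lia.
- by move=> x; rewrite !inE => /mapP[i]; rewrite mem_iota => im ->; apply: inc.
- apply: block_three_free_mod => // i j n; exact: stanley_three_free.
apply: (block_covered_mod (M := M)) => //.
- have := independent_geometric l.+1 ind.
  rewrite addnS expnS -/k -/m expnS -mulnA -(independent_geometric _ ind).
  by rewrite -/k -/m => ->; lia.
- by rewrite -/m subn1 in eN; lia.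
- by move=> x; apply: stanley_covers.
Qed.
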